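(* Let $A\in\mathbb{R}^{M\times N}$ with $M<N$ have nonzero columns, let $d\in\mathbb{R}^M$ and $\beta>0$, and let $F_d(u)=\|Au-d\|_2^2+\beta\|u\|_0$ for $u\in\mathbb{R}^N$. Then: (i) the set of global minimizers of $F_d$, $$\hat U=\left\{\hat u\in\mathbb{R}^N: F_d(\hat u)=\min_{u\in\mathbb{R}^N}F_d(u)\right\},$$ is nonempty; (ii) every $\hat u\in\hat U$ is a strict minimizer of $F_d$, i.e. $\sigma(\hat u)\in\Omega_{\max}$; hence $\|\hat u\|_0\le M$.
   Context: $\mathbb{I}_N=\{1,\dots,N\}$. For $u\in\mathbb{R}^N$, $\sigma(u)=\{i\in\mathbb{I}_N: u[i]\ne0\}$ and $\|u\|_0=\#\sigma(u)$. A (local) minimizer $\hat u$ of $F_d$ is strict if there is a neighborhood $O$ of $\hat u$ such that $F_d(\hat u)<F_d(v)$ for all $v\in O\setminus\{\hat u\}$. For $\omega\subseteq\mathbb{I}_N$, $A_\omega\in\mathbb{R}^{M\times\#\omega}$ is the submatrix of $A$ formed by the columns indexed by $\omega$ (in increasing order), with $\operatorname{rank}(A_\varnothing)=0$. For $r\in\{1,\dots,M\}$, $\Omega_r=\{\omega\subset\mathbb{I}_N:\#\omega=r=\operatorname{rank}(A_\omega)\}$; $\Omega_0=\{\varnothing\}$; $\Omega_{\max}=\bigcup_{r=0}^{M}\Omega_r$. *)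

(* Defs.v *)
From HB Require Import structures.
From mathcomp Require Import all_boot all_order all_algebra.
From mathcomp Require Import boolp classical_sets reals topology normedtype.

Set Implicit Arguments.
Unset Strict Implicit.
Unset Printing Implicit Defensive.

Import Order.TTheory GRing.Theory Num.Theory.
Import numFieldNormedType.Exports.

Local Open Scope classical_set_scope.
Local Open Scope ring_scope.

(* The normed-module norm `|v| on matrices is the sup norm, so the Euclidean
   norm is defined here. *)
Definition norm2 (R : realType) (m : nat) (v : 'cV[R]_m) : R :=
  Num.sqrt (\sum_(i < m) v i 0 ^+ 2).

(* Indices run over 'I_N = {0, ..., N-1} instead of {1, ..., N}. *)
Definition supp (R : realType) (N : nat) (u : 'cV[R]_N) : {set 'I_N} :=
  [set i : 'I_N | u i 0 != 0]%SET.

Definition norm0 (R : realType) (N : nat) (u : 'cV[R]_N) : nat := #|supp u|.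

Definition objective (R : realType) (M N : nat) (A : 'M[R]_(M, N))
    (d : 'cV[R]_M) (beta : R) (u : 'cV[R]_N) : R :=
  norm2 (A *m u - d) ^+ 2 + beta * (norm0 u)%:R.

Definition global_minimizers (R : realType) (N : nat) (F : 'cV[R]_N -> R) :
    set 'cV[R]_N :=
  [set u | forall v, F u <= F v].

Definition local_minimizer (R : realType) (N : nat) (F : 'cV[R]_N -> R)
    (u : 'cV[R]_N) : Prop :=
  exists2 O : set 'cV[R]_N, nbhs u O & forall v, O v -> F u <= F v.

Definition strict_minimizer (R : realType) (N : nat) (F : 'cV[R]_N -> R)
    (u : 'cV[R]_N) : Prop :=
  local_minimizer F u /\
  exists2 O : set 'cV[R]_N, nbhs u O & forall v, (O `\ u) v -> F u < F v.

(* [enum_val] lists the elements of a subset of 'I_N in increasing order. *)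
Definition subcols (R : realType) (M N : nat) (A : 'M[R]_(M, N))
    (w : {set 'I_N}) : 'M[R]_(M, #|w|) :=
  colsub (fun k : 'I_#|w| => enum_val k) A.

Definition Omega (R : realType) (M N : nat) (A : 'M[R]_(M, N)) (r : nat) :
    {set {set 'I_N}} :=
  if r == 0%N then [set finset.set0]%SET
  else [set w : {set 'I_N} | (#|w| == r) && (r == \rank (subcols A w))]%SET.

Definition Omega_max (R : realType) (M N : nat) (A : 'M[R]_(M, N)) :
    {set {set 'I_N}} :=
  (\bigcup_(r < M.+1) Omega A r)%SET.

(* Main.v *)
Require Import Defs.
From HB Require Import structures.
From mathcomp Require Import all_boot all_order all_algebra.
From mathcomp Require Import boolp classical_sets reals topology normedtype.
From mathcomp Require Import ring lra.

Set Implicit Arguments.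
Unset Strict Implicit.
Unset Printing Implicit Defensive.

Import Order.TTheory GRing.Theory Num.Theory.
Import numFieldNormedType.Exports.

Local Open Scope classical_set_scope.
Local Open Scope ring_scope.

(** For each support [w], least squares yields a minimizer of the residual
    among vectors supported in [w]; minimizing over the finitely many [w] gives
    a global minimizer. If [u] is one and [A z = 0] with [z != 0] supported in
    [supp u], then subtracting a multiple of [z] from [u] kills an entry without
    changing the residual, which contradicts optimality; hence the columns
    indexed by [supp u] are independent. Near [u], a vector [v] either has the
    support of [u], and strict convexity of the residual applies, or has a
    strictly larger support, and the gain [beta] beats the small change of the
    residual. *)

Lemma norm2_sqr (R : realType) (m : nat) (v : 'cV[R]_m) :
  norm2 v ^+ 2 = \sum_(i < m) v i 0 ^+ 2.
Proof. by rewrite sqr_sqrtr // sumr_ge0 // => i _; rewrite sqr_ge0. Qed.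

Lemma norm2_sqrE (R : realType) (m : nat) (v : 'cV[R]_m) :
  norm2 v ^+ 2 = (v^T *m v) 0 0.
Proof. by rewrite norm2_sqr !mxE; apply: eq_bigr => i _; rewrite mxE expr2. Qed.

Lemma norm2_sqr_eq0 (R : realType) (m : nat) (v : 'cV[R]_m) :
  (norm2 v ^+ 2 == 0) = (v == 0).
Proof.
rewrite norm2_sqr psumr_eq0 => [|i _]; last exact: sqr_ge0.
apply/allP/eqP => [v0|-> i _]; last by rewrite /= mxE expr0n /= eqxx.
apply/colP => i; have := v0 i (mem_index_enum i).
by rewrite sqrf_eq0 !mxE => /eqP.
Qed.

Lemma norm2_sqrD (R : realType) (m : nat) (u v : 'cV[R]_m) :
  norm2 (u + v) ^+ 2 =
  norm2 u ^+ 2 + norm2 v ^+ 2 + 2 * (u^T *m v) 0 0.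
Proof.
rewrite !norm2_sqr mxE mulr_sumr -!big_split /=.
by apply: eq_bigr => i _; rewrite !mxE; ring.
Qed.

(** The parallelogram identity; its last term measures strict convexity. *)
Lemma norm2_sqr_midpoint (R : realType) (m : nat) (u v : 'cV[R]_m) :
  norm2 (2^-1 *: (u + v)) ^+ 2 =
  2^-1 * (norm2 u ^+ 2 + norm2 v ^+ 2) - 4^-1 * norm2 (u - v) ^+ 2.
Proof.
rewrite !norm2_sqr -big_split /= !mulr_sumr -sumrB.
by apply: eq_bigr => i _; rewrite !mxE; field.
Qed.

(** If [x *m B^T *m B = 0], then multiplying by [x^T] shows that [B *m x^T] has norm zero. So
    passing from [B^T] to [B^T *m B] enlarges no kernel, and the ranks agree. This makes the normal
    equations solvable for every [B]. *)
Lemma gram_eqmx (R : realType) (m n : nat) (B : 'M[R]_(m, n)) :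
  (B^T *m B == B)%MS.
Proof.
rewrite -mxrank_leqif_eq ?submxMl // eqn_leq mxrankS ?submxMl //=.
have kerG : (kermx (B^T *m B) <= kermx B^T)%MS.
  apply/row_subP => i; apply/sub_kermxP.
  set x := row i _.
  have xG : x *m (B^T *m B) = 0.
    by apply/sub_kermxP; rewrite /x row_sub.
  apply: trmx_inj; rewrite trmx0; apply/eqP; rewrite -norm2_sqr_eq0 norm2_sqrE.
  by rewrite trmxK trmx_mul trmxK mulmxA -(mulmxA x) xG mul0mx mxE.
have := mxrankS kerG; rewrite !mxrank_ker mxrank_tr.
by rewrite leq_sub2lE // -{1}(mxrank_tr B) rank_leq_row.
Qed.

Lemma least_squares (R : realType) (m n : nat) (B : 'M[R]_(m, n))
    (d : 'cV[R]_m) :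
  exists x : 'cV[R]_n, forall y,
    norm2 (B *m x - d) ^+ 2 <= norm2 (B *m y - d) ^+ 2.
Proof.
(* The normal equations in transposed form; their solution [z^T] leaves a residual orthogonal to the
   columns of [B], and Pythagoras concludes. *)
have /submxP[z dB] : (d^T *m B <= B^T *m B)%MS.
  by rewrite (eqmxP (gram_eqmx B)) submxMl.
exists z^T => y.
have orth : (B *m z^T - d)^T *m B = 0.
  by rewrite linearB /= trmx_mul trmxK mulmxBl dB mulmxA subrr.
have -> : B *m y - d = (B *m z^T - d) + B *m (y - z^T).
  by rewrite mulmxBr [RHS]addrC addrA addrNK.
rewrite [leRHS]norm2_sqrD mulmxA orth mul0mx mxE mulr0 addr0.
by rewrite lerDl sqr_ge0.
Qed.

Lemma least_squares_supp (R : realType) (M N : nat) (A : 'M[R]_(M, N))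
    (d : 'cV[R]_M) (w : {set 'I_N}) :
  exists x : 'cV[R]_N, supp x \subset w /\
    forall y, supp y \subset w ->
      norm2 (A *m x - d) ^+ 2 <= norm2 (A *m y - d) ^+ 2.
Proof.
(* [D] projects onto the vectors supported in [w], so the constrained problem for [A] is the
   unconstrained one for [A *m D]. *)
pose D : 'M[R]_N := diag_mx (\row_j (j \in w)%:R).
have [x xmin] := least_squares (A *m D) d.
exists (D *m x); split.
  apply/fintype.subsetP => i; rewrite inE mul_diag_mx !mxE.
  by case: (i \in w); rewrite // mul0r eqxx.
move=> y /fintype.subsetP yw; have := xmin y; rewrite -!mulmxA.
suff -> : D *m y = y by [].
apply/colP => i; rewrite mul_diag_mx !mxE.
case: (boolP (i \in w)) => [_|iw]; first by rewrite mul1r.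
have : i \notin supp y by apply: contra iw; apply: yw.
by rewrite inE negbK => /eqP ->; rewrite mul0r.
Qed.

Lemma global_minimizers_nonempty (R : realType) (M N : nat) (A : 'M[R]_(M, N))
    (d : 'cV[R]_M) (beta : R) : 0 <= beta ->
  global_minimizers (objective A d beta) !=set0.
Proof.
move=> beta_ge0.
have [x xP] := choice (least_squares_supp A d).
(* [f w] bounds the objective at [x w] from above, since [supp (x w)] may be smaller than [w]; at
   [w = supp v] it is at most the objective at [v]. *)
pose f w := norm2 (A *m x w - d) ^+ 2 + beta * #|w|%:R.
case: (Order.TotalTheory.arg_minP f (i0 := finset.set0) (P := predT)) => // w _ wmin.
exists (x w) => v.
have [xw _] := xP w; have [_ xv] := xP (supp v).
apply: (@le_trans _ _ (f w)).
  by rewrite lerD2l ler_wpM2l // ler_nat subset_leq_card.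
by apply: (le_trans (wmin (supp v) isT)); rewrite lerD2r xv.
Qed.

Lemma global_minimizer_kernel (R : realType) (M N : nat) (A : 'M[R]_(M, N))
    (d : 'cV[R]_M) (beta : R) (u z : 'cV[R]_N) : 0 < beta ->
  global_minimizers (objective A d beta) u ->
  supp z \subset supp u -> A *m z = 0 -> z = 0.
Proof.
move=> beta_gt0 umin /fintype.subsetP zu Az; apply/colP => i; rewrite [RHS]mxE.
apply/eqP/negPn/negP => zi.
(* The coefficient cancels entry [i], and no entry outside [supp u] appears. *)
pose v := u - (u i 0 / z i 0) *: z.
have := umin v; rewrite /objective mulmxBr -scalemxAr Az scaler0 subr0.
apply/negP; rewrite -ltNge ltrD2l ltr_pM2l // ltr_nat.
apply: proper_card; apply/properP; split.
  apply/fintype.subsetP => j; rewrite !inE; apply: contra => /eqP uj.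
  have : j \notin supp z by apply/negP => /zu; rewrite inE uj eqxx.
  by rewrite inE negbK !mxE uj => /eqP ->; rewrite mulr0 subr0.
exists i; first by apply: zu; rewrite inE.
by rewrite inE negbK !mxE divfK // subrr.
Qed.

(** [subcols 1%:M w] is the embedding that pads a vector indexed by [w] with zeros. *)
Lemma subcolsE (R : realType) (M N : nat) (A : 'M[R]_(M, N))
    (w : {set 'I_N}) : subcols A w = A *m subcols 1%:M w.
Proof. by rewrite /subcols mulmx_colsub mulmx1. Qed.

Lemma subcols_row_free (R : realType) (M N : nat) (A : 'M[R]_(M, N))
    (w : {set 'I_N}) :
  (forall z, supp z \subset w -> A *m z = 0 -> z = 0) ->
  row_free (subcols A w)^T.
Proof.
move=> kerA; apply: inj_row_free => v vA.
pose z := subcols 1%:M w *m v^T.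
have zE i : z i 0 = \sum_k (i == enum_val k)%:R * v 0 k.
  by rewrite mxE; apply: eq_bigr => k _; rewrite !mxE.
have Az : A *m z = 0.
  by rewrite mulmxA -subcolsE; apply: trmx_inj; rewrite trmx_mul trmxK vA trmx0.
have z0 : z = 0.
  apply: kerA => //; apply/fintype.subsetP => i; rewrite inE; apply: contraR => iw.
  rewrite zE big1 // => k _; case: eqP => [ik|_]; last by rewrite mul0r.
  by rewrite ik enum_valP in iw.
apply/rowP => k; have := zE (enum_val k).
rewrite z0 (bigD1 k) //= eqxx mul1r big1 => [|l lk].
  by rewrite addr0 !mxE => <-.
by rewrite (inj_eq enum_val_inj) eq_sym (negbTE lk) mul0r.
Qed.

Lemma near_supp (R : realType) (N : nat) (u : 'cV[R]_N) :
  \forall v \near u, supp u \subset supp v.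
Proof.
have near_i (i : 'I_N) : \forall v \near u, u i 0 != 0 -> (v : 'cV[R]_N) i 0 != 0.
  case: (eqVneq (u i 0) 0) => [_|ui]; first by apply: filterE.
  have coord_u : (v : 'cV[R]_N) i 0 @[v --> u] --> u i 0 by exact: coord_continuous.
  by apply: filterS (cvgr_neq0 _ coord_u ui).
have : nbhs u [set v : 'cV[R]_N | forall i, u i 0 != 0 -> v i 0 != 0].
  pose f i := [set v : 'cV[R]_N | u i 0 != 0 -> v i 0 != 0].
  exact: (@filter_forall _ _ f (nbhs u) _ near_i).
apply: filterS => v vP.
by apply/fintype.subsetP => i; rewrite !inE; apply: vP.
Qed.

Lemma residual_cvg (R : realType) (M N : nat) (A : 'M[R]_(M, N))
    (d : 'cV[R]_M) (u : 'cV[R]_N) :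
  norm2 (A *m v - d) ^+ 2 @[v --> u] --> norm2 (A *m u - d) ^+ 2.
Proof.
have nbhsF : Filter (nbhs u) by exact: nbhs_filter.
under eq_fun do rewrite norm2_sqr.
rewrite norm2_sqr; apply: cvg_big => [|i _]; first exact: add_continuous.
under eq_fun do rewrite mxE expr2.
rewrite !mxE expr2.
have entry : (A *m v) i 0 + (- d) i 0 @[v --> u] -->
    (\sum_j A i j * u j 0) + (- d) i 0.
  apply: cvgD; last exact: cvg_cst.
  under eq_fun do rewrite mxE.
  apply: cvg_big => [|j _]; first exact: add_continuous.
  by apply: cvgM; [exact: cvg_cst|exact: coord_continuous].
by rewrite mxE in entry; apply: cvgM.
Qed.

(** The midpoint of [u] and [v] has no larger penalty than [u], so optimality of [u] bounds its
    residual from below; were the residual of [v] no larger than that of [u], strict convexity would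
    violate this bound. *)
Lemma global_minimizer_same_supp (R : realType) (M N : nat) (A : 'M[R]_(M, N))
    (d : 'cV[R]_M) (beta : R) (u v : 'cV[R]_N) : 0 < beta ->
  global_minimizers (objective A d beta) u ->
  supp v = supp u -> v != u -> objective A d beta u < objective A d beta v.
Proof.
move=> beta_gt0 umin vu neq.
have sub_supp (x : 'cV[R]_N) :
    (forall i, u i 0 = 0 -> v i 0 = 0 -> x i 0 = 0) -> supp x \subset supp u.
  move=> xP; apply/fintype.subsetP => i; apply: contraLR => iu.
  have : i \notin supp v by rewrite vu.
  by move: iu; rewrite !inE !negbK => /eqP u0 /eqP v0; apply/eqP/xP.
(* Otherwise [u - v], supported in [supp u], would lie in the kernel of [A] and vanish. *)
have uv_pos : 0 < norm2 ((A *m u - d) - (A *m v - d)) ^+ 2.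
  rewrite lt_def sqr_ge0 norm2_sqr_eq0 andbT opprB addrA addrNK -mulmxBr.
  apply: contraNneq neq => Auv.
  suff /eqP : u - v = 0 by rewrite subr_eq0 eq_sym.
  apply: (global_minimizer_kernel beta_gt0 umin) => //.
  by apply: sub_supp => i ui vi; rewrite !mxE ui vi subrr.
pose m := 2^-1 *: (u + v).
have mu : supp m \subset supp u.
  by apply: sub_supp => i ui vi; rewrite !mxE ui vi addr0 mulr0.
have Am : A *m m - d = 2^-1 *: ((A *m u - d) + (A *m v - d)).
  by rewrite -scalemxAr mulmxDr; apply/colP => i; rewrite !mxE; field.
have card_m : beta * (norm0 m)%:R <= beta * (norm0 u)%:R.
  by rewrite ler_wpM2l ?(ltW beta_gt0) // ler_nat subset_leq_card.
have := umin m; rewrite /objective Am norm2_sqr_midpoint {4}/norm0 vu -/(norm0 u).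
lra.
Qed.

Lemma global_minimizer_strict (R : realType) (M N : nat) (A : 'M[R]_(M, N))
    (d : 'cV[R]_M) (beta : R) (u : 'cV[R]_N) : 0 < beta ->
  global_minimizers (objective A d beta) u ->
  strict_minimizer (objective A d beta) u.
Proof.
move=> beta_gt0 umin; split.
  by exists setT => [|v _]; [exact: filterT|exact: umin].
exists [set v | v != u -> objective A d beta u < objective A d beta v]; last first.
  by move=> v [vP /eqP /vP].
(* Tolerance [beta]: near [u] the residual falls by less than the cost of one extra nonzero
   entry. *)
have /cvgrPdist_lt/(_ _ beta_gt0) near_res := @residual_cvg R M N A d u.
apply: filterS2 near_res (near_supp u) => v.
rewrite ltr_norml => /andP[_ res_v] sub_uv neq.
have [/esym uv|uv] := eqVneq (supp u) (supp v).
  exact: global_minimizer_same_supp.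
have card_uv : (norm0 u < norm0 v)%N.
  by apply: proper_card; rewrite finset.properEneq uv.
have : beta * (norm0 u).+1%:R <= beta * (norm0 v)%:R.
  by rewrite ler_wpM2l ?(ltW beta_gt0) // ler_nat.
by rewrite /objective -natr1 mulrDr mulr1; lra.
Qed.

Theorem theorem4p4 (R : realType) (M N : nat) (A : 'M[R]_(M, N))
    (d : 'cV[R]_M) (beta : R)
    (ltMN : (M < N)%N)
    (nonzero_cols : forall j : 'I_N, col j A != 0)
    (beta_gt0 : 0 < beta) :
  global_minimizers (objective A d beta) !=set0 /\
  (forall u : 'cV[R]_N, global_minimizers (objective A d beta) u ->
     [/\ strict_minimizer (objective A d beta) u,
         supp u \in Omega_max A
       & (norm0 u <= M)%N]).
Proof.
split; first exact: global_minimizers_nonempty (ltW beta_gt0).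
move=> u umin.
have /eqP rk : row_free (subcols A (supp u))^T.
  by apply: subcols_row_free => z; apply: (global_minimizer_kernel beta_gt0 umin).
rewrite mxrank_tr in rk.
have card_u : (#|supp u| <= M)%N by rewrite -{1}rk rank_leq_row.
split=> //; first exact: global_minimizer_strict.
(* [card_u] keeps [inord] from falling back to its default; rank zero is split off as in [Omega]. *)
apply/bigcupP; exists (inord #|supp u|) => //; rewrite inordK // /Omega.
case: eqP => [/eqP|_]; first by rewrite cards_eq0 => /eqP ->; rewrite inE.
by rewrite inE eqxx rk eqxx.
Qed.
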